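(* Let $q$ be a prime power and let $n,k,\delta$ be positive integers with $n\geq2k\geq 2\delta$. Then $$\bar{A}_q(n,2\delta,k)\geq q^{(n-k)(k-\delta+1)}+A^R_q(k\times (n-k), \delta, [0,k-\delta]).$$
   Context: $\mathcal G_q(n,k)$ is the set of $k$-dimensional subspaces of $\mathbb F_q^n$, with subspace distance $d_S(\mathcal U,\mathcal V)=\dim\mathcal U+\dim\mathcal V-2\dim(\mathcal U\cap\mathcal V)$. An $(n,d,k)_q$-CDC is a subset of $\mathcal G_q(n,k)$ with pairwise subspace distance at least $d$. An MRD$[k\times(n-k),\delta]_q$ code is an $\mathbb F_q$-linear subspace of $\mathbb F_q^{k\times(n-k)}$ of dimension $\max\{k,n-k\}(\min\{k,n-k\}-\delta+1)$ whose nonzero elements all have rank at least $\delta$. A lifted MRD code is $\{\mathrm{rowspace}(\boldsymbol I_k\mid\boldsymbol A):\boldsymbol A\in\mathcal D\}$ for such $\mathcal D$. $\bar A_q(n,2\delta,k)$ denotes the maximum number of codewords of an $(n,2\delta,k)_q$-CDC containing a lifted MRD code (of size $q^{(n-k)(k-\delta+1)}$) as a subset. For $K\subseteq\{0,\dots,n-k\}$, $A^R_q(k\times(n-k),\delta,K)$ is the maximum size of a set of matrices in $\mathbb F_q^{k\times(n-k)}$, each of rank in $K$, with pairwise rank distance $\mathrm{rank}(\boldsymbol D_1-\boldsymbol D_2)\ge\delta$. $[a,b]$ denotes the integers $x$ with $a\le x\le b$. *)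

(* Defs.v *)
From HB Require Import structures.
From mathcomp Require Import all_boot all_algebra.

Set Implicit Arguments.
Unset Strict Implicit.
Unset Printing Implicit Defensive.

Import GRing.Theory.

(* A subspace of a finite-dimensional vT is stored as a canonical matrix, so
   {vspace vT} is finite over a finite field. *)
Section FinVspace.

Import VectorInternalTheory.

HB.instance Definition _ (F : finFieldType) (vT : vectType F) :=
  [Countable of {vspace vT} by <:].
HB.instance Definition _ (F : finFieldType) (vT : vectType F) :=
  [Finite of {vspace vT} by <:].

End FinVspace.

Local Open Scope ring_scope.

Section Codes.

Variable F : finFieldType.

(* The truncated subtraction is exact: U :&: V is contained in U and in V. *)
Definition subspace_dist (n : nat) (U V : {vspace 'rV[F]_n}) : nat :=
  (\dim U + \dim V - 2 * \dim (U :&: V))%N.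

Definition is_CDC (n d k : nat) (C : {set {vspace 'rV[F]_n}}) : bool :=
  [forall U in C, \dim U == k]
  && [forall U in C, forall V in C, (U != V) ==> (d <= subspace_dist U V)%N].

Definition is_MRD (k m delta : nat) (D : {vspace 'M[F]_(k, m)}) : bool :=
  (\dim D == maxn k m * (minn k m - delta + 1))%N
  && [forall A in D, (A != 0) ==> (delta <= \rank A)%N].

Definition rowspace (k n : nat) (M : 'M[F]_(k, n)) : {vspace 'rV[F]_n} :=
  <<[seq row i M | i : 'I_k]>>%VS.

(* (I_k | A) has k + (n - k) columns; conform_mx casts it to n columns.  For
   k > n, where the two widths differ, conform_mx returns its default 0. *)
Definition identity_block (n k : nat) (A : 'M[F]_(k, n - k)) : 'M[F]_(k, n) :=
  conform_mx 0 (row_mx 1%:M A).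

Definition lifted_code (n k : nat) (D : {vspace 'M[F]_(k, n - k)}) :
    {set {vspace 'rV[F]_n}} :=
  [set rowspace (identity_block A) | A in D].

Definition contains_lifted_MRD (n k delta : nat)
    (C : {set {vspace 'rV[F]_n}}) : bool :=
  [exists D : {vspace 'M[F]_(k, n - k)},
     is_MRD delta D && (lifted_code D \subset C)].

Definition is_rank_code (k m delta : nat) (K : {pred nat})
    (S : {set 'M[F]_(k, m)}) : bool :=
  [forall A in S, \rank A \in K]
  && [forall A in S, forall B in S,
        (A != B) ==> (delta <= \rank (A - B)%R)%N].

End Codes.

(* The maximum \bar A_q(n, 2 * delta, k), for q = #|F|; the second argument is
   half of the minimum distance.  It is 0 if there is no such code. *)
Definition Abar (F : finFieldType) (n delta k : nat) : nat :=
  \max_(C : {set {vspace 'rV[F]_n}}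
        | is_CDC (2 * delta)%N k C && contains_lifted_MRD k delta C) #|C|.

(* The maximum A^R_q(k x m, delta, K), for q = #|F|. *)
Definition AR (F : finFieldType) (k m delta : nat) (K : {pred nat}) : nat :=
  \max_(S : {set 'M[F]_(k, m)} | is_rank_code delta K S) #|S|.

(* Main.v *)
(* The linear part is a Gabidulin code: with L/F of degree n - k and q = #|F|,
   evaluate the linearized polynomials sum_(i <= k - delta) c_i x^(q^i) over L
   at k elements that are independent over F, and expand the values in a basis
   of L.  A nonzero such polynomial has at most q^(k - delta) roots, so its
   matrix has rank at least delta.

   As n - k >= k, a k x (n - k) matrix B splits as (B1 | B2) with B1 square.
   Add to the lifted code of the MRD code the row spaces of (B1 | I_k | B2), B
   in an optimal rank code with ranks at most k - delta.  The row spaces of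
   (I_k | A) and (B1 | I_k | B2) meet in a space of dimension at most
   rank B1 <= k - delta, because a vector of the former is determined by its
   first k coordinates and those of the latter lie in the row space of B1. *)

Require Import Defs.
From HB Require Import structures.
From mathcomp Require Import all_boot all_algebra all_fingroup all_field.
From mathcomp Require Import zify.

Set Implicit Arguments.
Unset Strict Implicit.
Unset Printing Implicit Defensive.

Import GRing.Theory.

Section MRDCodes.

Local Open Scope ring_scope.

(** * Finite field extensions of prescribed degree *)

(** In a splitting field of [X^Q - X] with Q = |F|^m, the Q roots are distinct and form the fixed
    field of the m-th power of Frobenius. *)
Lemma finFieldExt_of_degree (F : finFieldType) (m : nat) :
  (0 < m)%N -> exists L : splittingFieldType F, \dim {:L} = m.
Proof.
move=> m_gt0; set Q := (#|F| ^ m)%N.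
have Q_gt1 : (1 < Q)%N.
  by rewrite -(exp1n m) ltn_exp2r // finNzRing_gt1.
pose p (R : nzRingType) : {poly R} := 'X^Q - 'X.
have p_size (R : nzRingType) : size (p R) = Q.+1.
  by rewrite size_polyDl size_polyXn // size_polyN size_polyX.
have p_neq0 : p F != 0 by rewrite -size_poly_eq0 p_size.
have [L [zs Dzs _]] := FinSplittingFieldFor p_neq0.
rewrite [map_poly _ _]rmorphB rmorphXn /= map_polyX -/(p L) in Dzs.
have [a _ Da] := finField_galois_generator (sub1v {:L}).
rewrite dimv1 expn1 in Da.
have Uzs : uniq zs.
  rewrite -separable_prod_XsubC -(eqp_separable Dzs) unlock.
  rewrite derivB derivXn derivX.
  (* Q is a positive power of the characteristic, so the derivative of [X^Q - X] is -1 and the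
     polynomial is separable. *)
  have -> : 'X^(Q.-1) *+ Q = 0 :> {poly L}.
    have [r _ pcharF] := finPcharP F.
    have pcharP : r \in [pchar {poly L}] by rewrite pchar_poly pchar_lalg.
    rewrite -mulr_natr /Q natrX (card_pprimeChar pcharF) natrX pcharf0 //.
    have e_gt0 : (0 < logn r #|F|)%N.
      rewrite lt0n; apply: contraTneq (finNzRing_gt1 F) => e0.
      by rewrite (card_pprimeChar pcharF) /= e0.
    by rewrite !expr0n !gtn_eqF // expr0n gtn_eqF // mulr0.
  by rewrite sub0r -scaleN1r coprimepZr ?coprimep1 ?oppr_eq0 ?oner_eq0.
pose E := fixedSpace (a ^+ m)%g.
have memE : zs =i E.
  move=> z; rewrite -root_prod_XsubC -(eqp_root Dzs) (sameP fixedSpaceP eqP).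
  rewrite /root !hornerE subr_eq0 /= /Q; congr (_ == z).
  elim: (m) => [|i IHi]; first by rewrite gal_id.
  by rewrite expgSr expnSr exprM IHi galM ?Da ?memvf.
(* The degree of [E] comes from counting: |F|^(dim E) = |E| = Q = |F|^m. *)
exists (FinSplittingFieldType F (subvs_of E)).
rewrite dimvf -[LHS]/(\dim E); apply: (@expnI #|F|); first exact: finNzRing_gt1.
rewrite -(@card_vspace F (finvect_type L) _ E).
rewrite -(@eq_card (finvect_type L) _ _ memE) (@card_uniqP (finvect_type L) _ Uzs).
by apply: succn_inj; rewrite -(size_prod_XsubC _ id) -(eqp_size Dzs) p_size.
Qed.

(** * Linearized polynomials and Gabidulin codes *)

Section Gabidulin.

Variables (F : finFieldType) (L : splittingFieldType F).
Local Notation q := #|F|.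

(** This map is the i-th power of the Frobenius generator of the Galois group of L over F. *)
Lemma Frobenius_power_linear (i : nat) : linear (fun x : L => x ^+ (q ^ i)).
Proof.
have [a _ Da] := finField_galois_generator (sub1v {:L}).
rewrite dimv1 expn1 in Da.
have E x : x ^+ (q ^ i) = (a ^+ i)%g x.
  elim: i => [|i IHi]; first by rewrite gal_id.
  by rewrite expgSr expnSr exprM IHi galM ?Da ?memvf.
by move=> c x y; rewrite !E linearP.
Qed.

Variable t : nat.
Implicit Type c : {ffun 'I_t -> L}.

Definition linearized c (x : L) : L := \sum_i c i * x ^+ (q ^ i).

Lemma linearized_is_linear c : linear (linearized c).
Proof.
move=> a x y; rewrite /linearized scaler_sumr -big_split /=.
by apply: eq_bigr => i _; rewrite Frobenius_power_linear mulrDr scalerAr.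
Qed.

Lemma linearized_roots c (s : seq L) :
  c != 0 -> uniq s -> all (fun x => linearized c x == 0) s ->
  (size s <= q ^ t.-1)%N.
Proof.
move=> c_neq0 Us s0.
pose p : {poly L} := \sum_i c i *: 'X^(q ^ i).
(* The exponents q^i are distinct, so each c_i is a coefficient of [p]. *)
have p_neq0 : p != 0.
  apply: contraNneq c_neq0 => p0; apply/eqP/ffunP => i; rewrite ffunE.
  have := coef0 L (q ^ i)%N; rewrite -p0 coef_sum (bigD1 i) //= big1.
    by rewrite coefZ coefXn eqxx mulr1 addr0.
  move=> j ne_ji; rewrite coefZ coefXn eqn_exp2l ?finNzRing_gt1 //.
  by rewrite eq_sym val_eqE (negPf ne_ji) mulr0.
have p_size : (size p <= (q ^ t.-1).+1)%N.
  apply: (leq_trans (size_sum _ _ _)); apply/bigmax_leqP => i _.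
  apply: (leq_trans (size_scale_leq _ _)); rewrite size_polyXn ltnS.
  by rewrite leq_exp2l ?finNzRing_gt1 // -ltnS (ltn_predK (ltn_ord i)).
rewrite -ltnS; apply: leq_trans p_size; apply: max_poly_roots => //.
apply: sub_all s0 => x; rewrite /root /p horner_sum; congr (_ == 0).
by apply: eq_bigr => i _; rewrite !hornerE.
Qed.

Variables (k m : nat) (X : m.-tuple L) (Y : k.-tuple L).
Hypotheses (basisX : basis_of {:L} X) (freeY : free Y).

Definition gabidulin_mx c : 'M[F]_(k, m) :=
  \matrix_(i, j) coord X j (linearized c Y`_i).

Lemma gabidulin_mx_is_linear : linear gabidulin_mx.
Proof.
move=> a c d; apply/matrixP => i j; rewrite !mxE -linearP; congr (coord X j _).
rewrite /linearized scaler_sumr -big_split /=.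
by apply: eq_bigr => l _; rewrite !ffunE mulrDl scalerAl.
Qed.

HB.instance Definition _ :=
  GRing.isLinear.Build F {ffun 'I_t -> L} 'M[F]_(k, m) _ gabidulin_mx
    gabidulin_mx_is_linear.

(** The left kernel of the matrix, of dimension k minus the rank, embeds into the roots of the
    linearized polynomial, of which there are at most q^(t-1). *)
Lemma gabidulin_mx_rank c : c != 0 -> (k - t.-1 <= \rank (gabidulin_mx c))%N.
Proof.
move=> c_neq0; set A := gabidulin_mx c.
rewrite leq_subLR addnC -leq_subLR -mxrank_ker.
set K := row_base (kermx A).
(* [g] reads a kernel vector as a combination of the evaluation points [Y]; it is injective as [Y]
   is free. *)
pose g (v : 'rV[F]_(\rank (kermx A))) : L := \sum_i (v *m K) 0 i *: Y`_i.
have g_inj : injective g.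
  move=> v w eq_vw; apply: (row_free_inj (row_base_free (kermx A))).
  apply/rowP => i; rewrite -/K.
  by rewrite -(coord_sum_free (fun i => (v *m K) 0 i) i freeY) -/(g v) eq_vw coord_sum_free.
have g0 v : linearized c (g v) = 0.
  pose f : {linear L -> L} := HB.pack (linearized c)
    (GRing.isLinear.Build F L L _ _ (linearized_is_linear c)).
  have -> : linearized c (g v) = \sum_i (v *m K) 0 i *: linearized c Y`_i.
    by rewrite -[LHS]/(f (g v)) raddf_sum; apply: eq_bigr => i _; apply: (linearZ_LR f).
  rewrite [LHS](coord_basis basisX (memvf _)) big1 // => j _.
  have /rowP/(_ j) : v *m K *m A = 0.
    by apply/sub_kermxP; rewrite -(eq_row_base (kermx A)) submxMl.
  rewrite mxE [RHS]mxE => vKA0; rewrite linear_sum.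
  rewrite (_ : \sum_i _ = 0) ?scale0r // -[RHS]vKA0; apply: eq_bigr => i _.
  by rewrite linearZ [A i j]mxE.
rewrite -(@leq_exp2l #|F|) ?finNzRing_gt1 //.
rewrite -[X in (_ ^ X)%N]mul1n -card_mx cardE -(size_map g).
apply: linearized_roots c_neq0 _ _; first by rewrite map_inj_uniq ?enum_uniq.
by apply/allP => _ /mapP[v _ ->]; rewrite g0.
Qed.

End Gabidulin.

Lemma gabidulin_MRD (F : finFieldType) (k m delta : nat) :
  (0 < delta <= k)%N -> (k <= m)%N ->
  exists D : {vspace 'M[F]_(k, m)}, is_MRD delta D.
Proof.
move=> /andP[delta_gt0 le_dk] le_km.
have k_gt0 := leq_trans delta_gt0 le_dk.
have [L dimL] := finFieldExt_of_degree F (leq_trans k_gt0 le_km).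
move: (vbasis {:L}) (vbasisP {:L}); rewrite dimL => X basisX.
have size_Y : size (take k X) == k by rewrite size_takel ?size_tuple.
have freeY : free (Tuple size_Y).
  by have:= basis_free basisX; rewrite /= -{1}(cat_take_drop k X) => /catl_free.
(* With this many coefficients the rank bound k - (t - 1) is delta and the dimension over F is t *
   m. *)
set t := (k - delta + 1)%N.
pose f : {linear {ffun 'I_t -> L} -> 'M[F]_(k, m)} := @gabidulin_mx F L t k m X (Tuple size_Y).
have rank_f c : c != 0 -> (delta <= \rank (f c))%N.
  move/(gabidulin_mx_rank basisX freeY); apply: leq_trans.
  by rewrite /t addn1 subKn.
exists (limg (linfun f)); apply/andP; split; last first.
  apply/forall_inP => _ /memv_imgP[c _ ->]; rewrite lfunE; apply/implyP => fc0.
  by apply/rank_f; apply: contraNneq fc0 => ->; rewrite linear0.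
rewrite (maxn_idPr le_km) (minn_idPl le_km) limg_dim_eq.
  by rewrite dimvf /= /dim /= card_ord -dimL dimvf mulnC.
(* [f] is injective: a nonzero [c] has an image of rank at least delta > 0. *)
apply/eqP; rewrite -subv0; apply/subvP => c /memv_capP[_].
rewrite memv_ker lfunE memv0 => fc0; apply: contraTT delta_gt0 => /rank_f.
by rewrite (eqP fc0) mxrank0 leqn0 -eqn0Ngt.
Qed.

(** * Row spaces and their intersections *)

Section RowspaceCodes.

Variable F : finFieldType.

Lemma rowspace_limg (k n : nat) (M : 'M[F]_(k, n)) :
  rowspace M = limg (linfun (mulmxr M : 'rV_k -> 'rV_n)).
Proof.
apply/eqP; rewrite eqEsubv; apply/andP; split.
  apply/span_subvP => _ /mapP[i _ ->]; apply/memv_imgP.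
  by exists (delta_mx 0 i); rewrite ?memvf // lfunE /= rowE.
apply/subvP => _ /memv_imgP[u _ ->]; rewrite lfunE /= mulmx_sum_row.
by apply: rpred_sum => i _; apply/memvZ/memv_span/map_f; rewrite mem_enum.
Qed.

Lemma rowspaceP (k n : nat) (M : 'M[F]_(k, n)) (v : 'rV_n) :
  reflect (exists u, v = u *m M) (v \in rowspace M).
Proof.
rewrite rowspace_limg; apply: (iffP memv_imgP) => [[u _ ->]|[u ->]].
  by exists u; rewrite lfunE.
by exists u; rewrite ?memvf ?lfunE.
Qed.

Lemma dim_rowspace_free (k n : nat) (M : 'M[F]_(k, n)) :
  row_free M -> \dim (rowspace M) = k.
Proof.
move=> freeM; rewrite rowspace_limg limg_dim_eq ?dimvf /dim /= ?mul1n //.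
apply/eqP; rewrite -subv0; apply/subvP => u /memv_capP[_].
rewrite memv_ker lfunE /= memv0 => /eqP uM0.
by apply/eqP/(row_free_inj freeM); rewrite uM0 mul0mx.
Qed.

Lemma dim_rowspace (k n : nat) (M : 'M[F]_(k, n)) :
  \dim (rowspace M) = \rank M.
Proof.
rewrite -[RHS](dim_rowspace_free (row_base_free M)); congr (\dim _).
apply/vspaceP => v; apply/rowspaceP/rowspaceP => [] [u ->].
  have /submxP[w ->] : (u *m M <= row_base M)%MS by rewrite eq_row_base submxMl.
  by exists w.
have /submxP[w ->] : (u *m row_base M <= M)%MS.
  by rewrite (submx_trans (submxMl _ _)) ?eq_row_base.
by exists w.
Qed.

(** The intersection lies in the row space of [P *m M]. *)
Lemma dim_cap_rowspace (k l r n : nat) (M : 'M[F]_(k, n)) (N : 'M[F]_(l, n))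
    (P : 'M[F]_(r, k)) :
  (forall (u : 'rV_k) (w : 'rV_l), u *m M = w *m N -> (u <= P)%MS) ->
  (\dim (rowspace M :&: rowspace N) <= \rank P)%N.
Proof.
move=> capP; apply: leq_trans (mxrankM_maxl P M).
rewrite -dim_rowspace; apply/dimvS/subvP => v /memv_capP[].
move=> /rowspaceP[u ->] /rowspaceP[w /capP/submxP[x ->]].
by apply/rowspaceP; exists x; rewrite mulmxA.
Qed.

(** The distance is 2k minus twice the dimension of the intersection. Since delta > 0, equal images
    would meet in dimension k > k - delta, so [g] is injective on [T]. *)
Lemma CDC_imset (I : finType) (T : {set I}) (n k delta : nat)
    (g : I -> {vspace 'rV[F]_n}) :
  (0 < delta <= k)%N -> (forall x, x \in T -> \dim (g x) = k) ->
  (forall x y, x \in T -> y \in T -> x != y ->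
     \dim (g x :&: g y) <= k - delta)%N ->
  is_CDC (2 * delta) k (g @: T) /\ #|g @: T| = #|T|.
Proof.
case/andP=> delta_gt0 le_dk dimg capg; split; last first.
  apply: card_in_imset => x y xT yT eq_g; apply: contraTeq delta_gt0 => ne_xy.
  by have := capg _ _ xT yT ne_xy; rewrite eq_g capvv dimg //; lia.
apply/andP; split.
  by apply/forall_inP => _ /imsetP[x xT ->]; rewrite dimg.
apply/forall_inP => _ /imsetP[x xT ->]; apply/forall_inP => _ /imsetP[y yT ->].
apply/implyP => ne_g; rewrite /subspace_dist !dimg //.
have ne_xy : x != y by apply: contraNneq ne_g => ->.
by have := capg _ _ xT yT ne_xy; lia.
Qed.

(** * The lifted code and its extension *)

Variables k m' : nat.

Local Notation m := (k + m')%N.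

Definition systematic_mx (A : 'M[F]_(k, m)) : 'M[F]_(k, k + m) :=
  row_mx 1%:M A.

(** Writing the width as k + m', with m' = n - 2k, makes [lsubmx B] the square block B1 and
    [rsubmx B] the block B2. *)
Definition shifted_mx (B : 'M[F]_(k, m)) : 'M[F]_(k, k + m) :=
  row_mx (lsubmx B) (row_mx 1%:M (rsubmx B)).

Lemma systematic_mx_free (A : 'M[F]_(k, m)) : row_free (systematic_mx A).
Proof. 
by apply/row_freeP; exists (col_mx 1%:M 0); rewrite mul_row_col mulmx1 mulmx0 addr0.
Qed.

Lemma shifted_mx_free (B : 'M[F]_(k, m)) : row_free (shifted_mx B).
Proof.
apply/row_freeP; exists (col_mx 0 (col_mx 1%:M 0)).
by rewrite !mul_row_col mulmx1 !mulmx0 addr0 add0r.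
Qed.

(** The identity blocks force u = w, so u lies in the left kernel of A - A'. *)
Lemma cap_systematic (A A' : 'M[F]_(k, m)) :
  (\dim (rowspace (systematic_mx A) :&: rowspace (systematic_mx A'))
     <= k - \rank (A - A')%R)%N.
Proof.
rewrite -mxrank_ker; apply: dim_cap_rowspace => u w.
rewrite !mul_mx_row !mulmx1 => /eq_row_mx[-> eqA].
by apply/sub_kermxP; rewrite mulmxBr eqA subrr.
Qed.

(** The middle identity blocks force u = w; the outer blocks together then give u B = u B'. *)
Lemma cap_shifted (B B' : 'M[F]_(k, m)) :
  (\dim (rowspace (shifted_mx B) :&: rowspace (shifted_mx B'))
     <= k - \rank (B - B')%R)%N.
Proof.
rewrite -mxrank_ker; apply: dim_cap_rowspace => u w.
rewrite !mul_mx_row !mulmx1 => /eq_row_mx[eqBl /eq_row_mx[equw eqBr]].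
rewrite -{}equw in eqBl eqBr; apply/sub_kermxP.
rewrite mulmxBr -[B]hsubmxK -[B']hsubmxK !mul_mx_row eqBl eqBr.
by rewrite subrr.
Qed.

Lemma cap_systematic_shifted (A B : 'M[F]_(k, m)) :
  (\dim (rowspace (systematic_mx A) :&: rowspace (shifted_mx B)) <= \rank B)%N.
Proof.
apply: (@leq_trans (\rank (lsubmx B))).
  apply: dim_cap_rowspace => u w; rewrite !mul_mx_row mulmx1.
  by move=> /eq_row_mx[-> _]; rewrite submxMl.
have -> : lsubmx B = B *m col_mx 1%:M 0.
  by rewrite -{2}[B]hsubmxK mul_row_col mulmx1 mulmx0 addr0.
exact: mxrankM_maxl.
Qed.

Variables (delta : nat) (D : {vspace 'M[F]_(k, m)}) (S : {set 'M[F]_(k, m)}).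
Hypotheses (delta_bounds : (0 < delta <= k)%N) (MRD_D : is_MRD delta D).
Hypothesis rank_code_S : is_rank_code delta [pred r | r <= k - delta]%N S.

(** The sum type keeps the two families of indices disjoint, so [CDC_imset] treats pairs within and
    across families at once and also yields the cardinality. *)
Definition extended_lifted_code : {set {vspace 'rV[F]_(k + m)}} :=
  [set rowspace (match x with inl A => systematic_mx A
                            | inr B => shifted_mx B end)
  | x in inl @: D :|: inr @: S].

Lemma extended_lifted_codeP :
  is_CDC (2 * delta) k extended_lifted_code
  /\ #|extended_lifted_code| = (#|F| ^ (m * (k - delta + 1)) + #|S|)%N.
Proof.
have [/eqP dimD /forall_inP rankD] := andP MRD_D.
have [/forall_inP rankS /forall_inP distS] := andP rank_code_S.
have cardT : #|inl @: D :|: inr @: S| = (#|F| ^ (m * (k - delta + 1)) + #|S|)%N.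
  rewrite cardsU (_ : _ :&: _ = set0) ?cards0 ?subn0; last first.
    apply/setP => x; rewrite !inE; apply/andP => -[/imsetP[A _ ->] /imsetP[B _]].
    by [].
  rewrite (card_imset _ (@inl_inj _ _)) (card_imset _ (@inr_inj _ _)).
  by rewrite card_vspace dimD (maxn_idPr _) ?(minn_idPl _) ?leq_addr.
rewrite -cardT; apply: CDC_imset => //.
  by case=> [A|B] _; rewrite dim_rowspace_free ?systematic_mx_free ?shifted_mx_free.
move=> _ _ /setUP[] /imsetP[A AD ->] /setUP[] /imsetP[B BD ->] ne_AB.
- apply: leq_trans (cap_systematic A B) (leq_sub2l _ _).
  apply: (implyP (rankD (A - B) _)); first exact: rpredB.
  by rewrite subr_eq0; apply: contraNneq ne_AB => ->.
- by apply: leq_trans (cap_systematic_shifted A B) _; apply: rankS.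
- by rewrite capvC; apply: leq_trans (cap_systematic_shifted B A) _; apply: rankS.
apply: leq_trans (cap_shifted A B) (leq_sub2l _ _).
apply: (implyP (forall_inP (distS A AD) B BD)).
by apply: contraNneq ne_AB => ->.
Qed.

End RowspaceCodes.

Lemma contains_lifted_MRDI (F : finFieldType) (n k delta : nat)
    (D : {vspace 'M[F]_(k, n - k)}) (C : {set {vspace 'rV[F]_n}}) :
  is_MRD delta D -> (forall A, A \in D -> rowspace (identity_block A) \in C) ->
  contains_lifted_MRD k delta C.
Proof.
move=> MRD_D subDC; apply/existsP; exists D; rewrite MRD_D.
by apply/subsetP => _ /imsetP[A AD ->]; apply: subDC.
Qed.

End MRDCodes.

Theorem theorem2p6 (F : finFieldType) (q n k delta : nat) (hq : #|F| = q)
    (hn0 : 0 < n) (hk0 : 0 < k) (hdelta0 : 0 < delta)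
    (hnk : 2 * k <= n) (hkdelta : 2 * delta <= 2 * k) :
  q ^ ((n - k) * (k - delta + 1))
    + AR F k (n - k) delta [pred r : nat | 0 <= r <= k - delta]
  <= Abar F n delta k.
Proof.
have delta_bounds : 0 < delta <= k by rewrite hdelta0 -(leq_pmul2l (ltn0Sn 1)).
have [m' def_m] : exists m', k + m' = n - k.
  by exists (n - k - k); rewrite subnKC //; lia.
have def_n : n = k + (n - k) by lia.
have [S codeS ->] : exists2 S : {set 'M[F]_(k, n - k)},
    is_rank_code delta [pred r | r <= k - delta] S
    & AR F k (n - k) delta [pred r : nat | 0 <= r <= k - delta] = #|S|.
  rewrite /AR.
  (* The maximum is attained because the empty set is an admissible code. *)
  have [|S codeS ->] := @eq_bigmax_cond _
    [pred S | is_rank_code delta [pred r : nat | 0 <= r <= k - delta] S]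
    (fun S : {set 'M[F]_(k, n - k)} => #|S|).
    apply/card_gt0P; exists set0; rewrite inE /is_rank_code.
    by apply/andP; split; apply/forall_inP => A; rewrite inE.
  by exists S.
have [D MRD_D] := gabidulin_MRD F delta_bounds (leq_trans (leq_addr m' k) (eq_leq def_m)).
have [C [CDC_C card_C lift_C]] : exists C : {set {vspace 'rV[F]_n}},
  [/\ is_CDC (2 * delta) k C,
     #|C| = #|F| ^ ((n - k) * (k - delta + 1)) + #|S|
   & forall A, A \in D -> rowspace (identity_block A) \in C].
  rewrite /identity_block.
  (* Replacing n - k by k + m' and n by k + (k + m') aligns the matrix types, so that [conform_mx]
     becomes the identity. *)
  move: (n - k) def_m def_n S codeS D MRD_D => m <- -> S codeS D MRD_D.
  exists (extended_lifted_code D S).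
  have [CDC_C card_C] := extended_lifted_codeP delta_bounds MRD_D codeS.
  split=> // A AD; rewrite conform_mx_id.
  by apply/imsetP; exists (inl A) => //; rewrite inE imset_f.
rewrite -hq -card_C /Abar.
apply: (@bigmax_sup _ C) => //.
by rewrite CDC_C; apply: contains_lifted_MRDI MRD_D lift_C.
Qed.
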